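(* Let $m\ge 1$ and $n=2m$. In $\mathbb{R}^{n+1}$, with coordinates indexed by $\{0,1,\dots,n\}$ and standard unit vectors $e_0,\dots,e_n$, let $q_1=e_1+e_2$ and $q_j=e_{2j-2}+e_{2j-1}+e_{2j}$ for $j=2,\dots,m$, and let $$L_m=\Bigl\{Y\in\mathbb{S}^{n+1}\ \Big|\ Y_{00}=1,\ \ Y_{ii}=Y_{0i}\ (i=1,\dots,n),\ \ \langle q_jq_j^T,Y\rangle=0\ (j=1,\dots,m)\Bigr\}.$$ Then SDD-partial facial reduction requires exactly $2m=n$ steps on $L_m\cap\mathbb{S}^{n+1}_+$.
   Context: Notation. $\mathbb{S}^p$ is the space of real symmetric $p\times p$ matrices with inner product $\langle X,Y\rangle=\operatorname{tr}(XY)$, and $\mathbb{S}^p_+$ is the positive semidefinite cone. For a set $S$ of matrices (including an affine subspace), $S^\perp=\{Z\mid\langle Z,X\rangle=0\ \forall X\in S\}$. $\operatorname{ri}$ denotes relative interior. The support of a vector is the set of indices of its nonzero entries. A basis matrix of a subspace is a matrix whose columns form a basis of it. SDD cone. $\mathbb{FW}_2^N\subseteq\mathbb{S}^N_+$ is the set of finite sums $\sum_t g_tg_t^T$ with $g_t\in\mathbb{R}^N$ having at most two nonzero entries. SDD-partial facial reduction on $L\cap\mathbb{S}^{n+1}_+$. Start with $L_{(0)}=L$ and $N_0=n+1$. At stage $t$, given an affine subspace $L_{(t)}\subseteq\mathbb{S}^{N_t}$: if $L_{(t)}^\perp\cap\mathbb{FW}_2^{N_t}=\{0\}$, terminate.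 Otherwise perform one step: choose an exposing matrix $W_t\in\operatorname{ri}(L_{(t)}^\perp\cap\mathbb{FW}_2^{N_t})$, take a basis matrix $V_t\in\mathbb{R}^{N_t\times N_{t+1}}$ of $\ker(W_t)$ with pairwise disjoint column supports (such a basis exists because $W_t\in\mathbb{FW}_2^{N_t}$, and it is unique up to permuting and rescaling its columns), and set $L_{(t+1)}=\{R\in\mathbb{S}^{N_{t+1}}\mid V_tRV_t^T\in L_{(t)}\}$. The number of steps required is the number of steps performed before termination. *)

(* Defs.v *)
From HB Require Import structures.
From mathcomp Require Import all_boot all_order all_algebra.
From mathcomp Require Import all_classical all_reals all_analysis.

Set Implicit Arguments.
Unset Strict Implicit.
Unset Printing Implicit Defensive.

Import Order.TTheory GRing.Theory Num.Theory.
Import numFieldNormedType.Exports.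

Local Open Scope classical_set_scope.
Local Open Scope ring_scope.

Section MatrixSets.
Variable R : realType.

Definition sym_mx N : set 'M[R]_N := [set X | X^T = X].

Definition mx_inner N (X Y : 'M[R]_N) : R := \tr (X *m Y).

(* The orthogonal complement is taken in the space of symmetric matrices. For
   an affine subspace S it is orthogonal to the points of S, not only to its
   directions. *)
Definition mx_perp N (S : set 'M[R]_N) : set 'M[R]_N :=
  [set Z | sym_mx Z /\ forall X, S X -> mx_inner Z X = 0].

Definition affine_hull N (C : set 'M[R]_N) : set 'M[R]_N :=
  [set X | exists (k : nat) (a : 'I_k -> R) (Y : 'I_k -> 'M[R]_N),
     [/\ \sum_i a i = 1, forall i, C (Y i) & X = \sum_i a i *: Y i]].

Definition rel_interior N (C : set 'M[R]_N) : set 'M[R]_N :=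
  [set X | C X /\ \forall Y \near X, affine_hull C Y -> C Y].

Definition vsupport N (v : 'cV[R]_N) : {set 'I_N} := finset (fun i => v i ord0 != 0).

Definition FW2 N : set 'M[R]_N :=
  [set X | exists (k : nat) (g : 'I_k -> 'cV[R]_N),
     (forall t, (#|vsupport (g t)| <= 2)%N) /\ X = \sum_t g t *m (g t)^T].

(* kermx is a row kernel: the row space of kermx W^T is {x^T | W x = 0}. *)
Definition ker_basis_mx N N' (W : 'M[R]_N) (V : 'M[R]_(N, N')) : Prop :=
  row_free V^T /\ (V^T == kermx W^T)%MS.

Definition disjoint_columns N N' (V : 'M[R]_(N, N')) : Prop :=
  forall j k : 'I_N', j != k ->
    (vsupport (col j V) :&: vsupport (col k V))%SET = finset.set0.

Definition fr_terminal N (L : set 'M[R]_N) : Prop :=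
  mx_perp L `&` @FW2 N = [set 0].

Definition fr_exposing N (L : set 'M[R]_N) : set 'M[R]_N :=
  rel_interior (mx_perp L `&` @FW2 N).

Definition fr_basis N N' (W : 'M[R]_N) (V : 'M[R]_(N, N')) : Prop :=
  ker_basis_mx W V /\ disjoint_columns V.

Definition fr_next N N' (L : set 'M[R]_N) (V : 'M[R]_(N, N')) : set 'M[R]_N' :=
  [set X | sym_mx X /\ L (V *m X *m V^T)].

(* SDD-partial facial reduction performs exactly k steps from L, whatever
   exposing matrices W and kernel bases V are chosen; the existential clauses
   say that the procedure never lacks a choice. The new order N' is determined
   by V, as its number of columns. *)
Fixpoint sdd_fr_requires (k N : nat) (L : set 'M[R]_N) : Prop :=
  if k is k'.+1 then
    [/\ ~ fr_terminal L,
        exists W, fr_exposing L W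
      & forall W, fr_exposing L W ->
          (exists (N' : nat) (V : 'M[R]_(N, N')), fr_basis W V) /\
          (forall (N' : nat) (V : 'M[R]_(N, N')), fr_basis W V ->
             sdd_fr_requires k' (fr_next L V))]
  else fr_terminal L.

Definition evec n (i : nat) : 'cV[R]_n.+1 := delta_mx (inord i) ord0.

(* Meaningful for 1 <= j <= m. *)
Definition qvec m (j : nat) : 'cV[R]_((2 * m).+1) :=
  if j == 1%N then evec _ 1 + evec _ 2
  else evec _ (2 * j - 2) + evec _ (2 * j - 1) + evec _ (2 * j).

Definition Lset m : set 'M[R]_((2 * m).+1) :=
  [set Y | [/\ sym_mx Y,
               Y ord0 ord0 = 1,
               forall i, i != ord0 -> Y i i = Y ord0 i
             & forall j : nat, (1 <= j <= m)%N ->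
                 mx_inner (qvec m j *m (qvec m j)^T) Y = 0]].

End MatrixSets.

(* Main.v *)
Require Import Defs.
From mathcomp Require Import all_boot all_order all_algebra.
From mathcomp Require Import all_classical all_reals all_analysis.
From mathcomp Require Import ring lra zify.

(** Let [r_k = e_{k+1} + e_{k+2}] for [k] even and [r_k = e_{k+1}] for [k] odd
    ([stage_vec]). After [k] steps the product [U] of the kernel bases chosen so
    far has disjoint column supports, and its range is the orthogonal complement
    of [r_0, .., r_{k-1}]. All such [U] are treated at once through a left
    inverse [T] such that [U T] is a fixed projection ([stage_proj]) whose
    columns also have disjoint supports; then [T^T] maps the two-sparse vectors
    [g] of a decomposition [Z = sum g g^T] in FW_2 to two-sparse vectors [h] of
    the original space.

    If [Z] is orthogonal to the current affine space, testing against the points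
    [e_0 e_0^T + u v^T + v u^T + e_0 d^T + d e_0^T], [d = 2 u.v] entrywise,
    yields [sum (h.u) (h.v) = 0]. With [u = v] a combination
    [e_{2j-1} - e_{2j} + e_{2j+1}] and, by descending induction on [j],
    [h_{2j+1} = 0], this forces [h_{2j-1} = h_{2j}]. When these are nonzero,
    sparsity gives [h_{2j-2} = 0], and a second test then gives [h_{2j-1} = 0].
    What survives is [h] proportional to [r_k], so the exposing cone is exactly
    the ray of [(U^T r_k) (U^T r_k)^T], and it is zero when [k = 2 m]. *)

Set Implicit Arguments.
Unset Strict Implicit.
Unset Printing Implicit Defensive.

Import Order.TTheory GRing.Theory Num.Theory.
Import numFieldNormedType.Exports.

Local Open Scope classical_set_scope.
Local Open Scope ring_scope.

(** * Disjoint column supports and two-sparse vectors *)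

Section DisjointColumns.
Variable R : realType.

Lemma in_vsupport N (v : 'cV[R]_N) i : (i \in vsupport v) = (v i ord0 != 0).
Proof. by rewrite finset.inE. Qed.

Lemma disjoint_columnsP p q (V : 'M[R]_(p, q)) :
  disjoint_columns V <->
  forall i j k, V i j != 0 -> V i k != 0 -> j = k.
Proof.
split=> [dV i j k Vij Vik|dV j k njk].
  apply/eqP/negPn/negP => /dV /finset.setP /(_ i).
  by rewrite finset.in_setI !in_vsupport !mxE Vij Vik finset.in_set0.
apply/finset.setP => i; rewrite finset.in_setI !in_vsupport !mxE finset.in_set0.
apply/negP => /andP[Vij Vik].
by move: njk; rewrite (dV i j k Vij Vik) eqxx.
Qed.

Lemma sum_neq0 (I : finType) (F : I -> R) :
  \sum_i F i != 0 -> exists i, F i != 0.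
Proof.
move=> sF; apply/existsP; apply: contraNT sF => /existsPn F0.
by rewrite big1 // => i _; apply/eqP/negPn/F0.
Qed.

Lemma sum_sqr_eq0 (I : finType) (a : I -> R) :
  \sum_t a t * a t = 0 -> forall t, a t = 0.
Proof.
move=> a0 t; apply/eqP; rewrite -sqrf_eq0 expr2; apply/eqP.
by apply: (psumr_eq0P _ a0) => // i _; rewrite -expr2 sqr_ge0.
Qed.

Lemma disjoint_columns_mul p q s (U : 'M[R]_(p, q)) (V : 'M[R]_(q, s)) :
  disjoint_columns U -> disjoint_columns V -> disjoint_columns (U *m V).
Proof.
move=> /disjoint_columnsP dU /disjoint_columnsP dV.
apply/disjoint_columnsP => i j k; rewrite !mxE.
move=> /sum_neq0[a]; rewrite mulf_eq0 negb_or => /andP[Ua Va].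
move=> /sum_neq0[b]; rewrite mulf_eq0 negb_or => /andP[Ub Vb].
by apply: (dV a) => //; rewrite (dU _ _ _ Ua Ub).
Qed.

(** As [T *m U = 1%:M], column [l] of [U] has a nonzero entry, in some row [a]. It is the only
    nonzero entry of that row, so row [a] of [U *m A] is a nonzero multiple of row [l] of [A]. *)
Lemma disjoint_columns_section p q s (U : 'M[R]_(p, q)) (T : 'M[R]_(q, p))
    (A : 'M[R]_(q, s)) :
  disjoint_columns U -> T *m U = 1%:M -> disjoint_columns (U *m A) ->
  disjoint_columns A.
Proof.
move=> /disjoint_columnsP dU TU /disjoint_columnsP dUA.
apply/disjoint_columnsP => l i j Ai Aj.
have /sum_neq0[a] : \sum_a T l a * U a l != 0.
  by move/matrixP/(_ l l): TU; rewrite !mxE eqxx => ->; rewrite oner_eq0.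
rewrite mulf_eq0 negb_or => /andP[_ Ual].
have UA t : (U *m A) a t = U a l * A l t.
  rewrite mxE (bigD1 l) //= big1 ?addr0 // => b bl.
  suff /eqP -> : U a b == 0 by rewrite mul0r.
  by apply: contraNT bl => Uab; apply/eqP/(dU a).
by apply: (dUA a); rewrite UA mulf_neq0.
Qed.

(** Each row of [V] meets at most one column. Sending a row to that column maps the support of [x]
    onto a set containing the support of [V^T *m x]. *)
Lemma card_vsupport_tr_mul p q (V : 'M[R]_(p, q)) (x : 'cV[R]_p) :
  disjoint_columns V -> (#|vsupport (V^T *m x)| <= #|vsupport x|)%N.
Proof.
move=> /disjoint_columnsP dV.
rewrite -(card_imset _ (@Some_inj _)).
pose f (i : 'I_p) := [pick j | V i j != 0].
apply: leq_trans (leq_imset_card f (vsupport x)).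
apply/subset_leq_card/fintype.subsetP => _ /imsetP[l lx ->].
move: lx; rewrite in_vsupport mxE => /sum_neq0[i]; rewrite mxE mulf_eq0 negb_or.
move=> /andP[Vil xi]; apply/imsetP; exists i; first by rewrite in_vsupport.
rewrite /f; case: pickP => [j Vij|/(_ l)]; last by rewrite Vil.
by rewrite (dV i l j).
Qed.

Lemma three_vsupport N (g : 'cV[R]_N) a b p :
  (#|vsupport g| <= 2)%N -> a != b -> a != p -> b != p ->
  g a ord0 != 0 -> g b ord0 != 0 -> g p ord0 = 0.
Proof.
move=> g2 ab ap bp ga gb; apply/eqP; apply: contraTT g2 => gp; rewrite -ltnNge.
have /card_uniqP /= abp3 : uniq [:: a; b; p].
  by rewrite /= !inE negb_or ab ap bp.
rewrite -abp3.
apply/subset_leq_card/fintype.subsetP => i; rewrite in_vsupport !inE.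
by case/or3P => /eqP ->.
Qed.
End DisjointColumns.

(** * Facial reduction when the exposing cone is a ray *)

Section Ray.
Variable R : realType.

Lemma outer_entry N (w : 'cV[R]_N) i j :
  (w *m w^T) i j = w i ord0 * w j ord0.
Proof. by rewrite mxE big_ord1 !mxE. Qed.

Lemma affine_hull_ray N (w : 'cV[R]_N) (Y : 'M[R]_N) :
  affine_hull [set t *: (w *m w^T) | t in [set t : R | 0 <= t]] Y <->
  exists t : R, Y = t *: (w *m w^T).
Proof.
split=> [[k [a [Z [_ CZ ->]]]]|[t ->]].
  have /boolp.choice[b bP] : forall i, exists b : R, Z i = b *: (w *m w^T).
    by move=> i; have [b _ <-] := CZ i; exists b.
  exists (\sum_i a i * b i); rewrite scaler_suml; apply: eq_bigr => i _.
  by rewrite bP scalerA.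
(* The hull is the whole line: every real [t] is allowed in the affine combination of 0 and
   [w *m w^T] with weights [1 - t] and [t]. *)
exists 2%N, (fun i : 'I_2 => if i == ord0 then 1 - t else t).
exists (fun i : 'I_2 => if i == ord0 then 0 else w *m w^T); split.
- by rewrite !big_ord_recl big_ord0 /= addr0 subrK.
- move=> i; case: ifP => _; first by exists 0; rewrite ?scale0r //= lexx.
  by exists 1; rewrite ?scale1r //= ler01.
- by rewrite !big_ord_recl big_ord0 /= scaler0 add0r addr0.
Qed.

(** A diagonal entry at which [w] is nonzero reads off the sign of the coefficient, and its
    positivity is an open condition. The apex is excluded because negative multiples lie in the
    affine hull arbitrarily close to it. *)
Lemma rel_interior_ray N (w : 'cV[R]_N) (W : 'M[R]_N) : w != 0 ->
  rel_interior [set t *: (w *m w^T) | t in [set t : R | 0 <= t]] W <->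
  exists2 t : R, 0 < t & W = t *: (w *m w^T).
Proof.
move=> /matrix0Pn[p [j]]; rewrite (ord1 j) => wp.
have wp2 : 0 < (w *m w^T) p p by rewrite outer_entry -expr2 exprn_even_gt0.
split=> [[[t /= t0 <-] nW]|[t t0 ->]]; last first.
  split; first by exists t => //=; exact: ltW.
  have tp : 0 < (t *: (w *m w^T)) p p by rewrite mxE mulr_gt0.
  have nP : nbhs (t *: (w *m w^T)) (fun Y : 'M[R]_N => 0 < Y p p).
    exact: (@coord_continuous R N N p p (t *: (w *m w^T)) _ (lt_nbhsr tp)).
  apply: filterS nP => Y Yp /affine_hull_ray[s Ys]; exists s => //=.
  move: Yp; rewrite Ys mxE pmulr_lgt0 //; exact: ltW.
exists t => //; rewrite lt_neqAle t0 andbT; apply/eqP => t0'.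
move: nW; rewrite -t0' scale0r => n0.
have n0' : nbhs (0 *: (w *m w^T)) (fun Y => affine_hull
    [set t *: (w *m w^T) | t in [set t : R | 0 <= t]] Y ->
    [set t *: (w *m w^T) | t in [set t : R | 0 <= t]] Y) by rewrite scale0r.
(* Pull the neighbourhood of the apex back to an interval of radius [e] around 0; the coefficient
   [- (e / 2)] then gives a contradiction. *)
have [e /= e0 eP] := @scalel_continuous R _ (w *m w^T) 0 _ n0'.
have [||s /= s0 /matrixP/(_ p p)] := eP (- (e / 2)).
- by rewrite /= sub0r opprK gtr0_norm; lra.
- by apply/affine_hull_ray; exists (- (e / 2)).
rewrite 2![(_ *: (_ *m _)) p p]mxE => /(mulIf (lt0r_neq0 wp2)) se.
by move: s0; rewrite se; lra.
Qed.
End Ray.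

Section Step.
Variable R : realType.

(** Restates the row-space conditions in the form used by the induction: a left inverse,
    annihilation by [w], and factorization through [V]. The scalar [t] disappears. *)
Lemma ker_basis_outerP N N' (w : 'cV[R]_N) (t : R) (V : 'M[R]_(N, N')) :
  t != 0 -> ker_basis_mx (t *: (w *m w^T)) V ->
  [/\ exists S, S *m V = 1%:M, w^T *m V = 0
    & forall q (A : 'M[R]_(N, q)), w^T *m A = 0 -> exists D, A = V *m D].
Proof.
move=> t0 [/row_freeP[S VS] /andP[/sub_kermxP VW kV]]; split.
- by exists S^T; rewrite -[V]trmxK -trmx_mul VS trmx1.
- have [->|/matrix0Pn[p [j]]] := eqVneq w 0; first by rewrite trmx0 mul0mx.
  rewrite (ord1 j) => wp.
  move/(congr1 trmx): VW; rewrite trmx_mul !trmxK trmx0 -scalemxAl -mulmxA.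
  move/eqP; rewrite scaler_eq0 (negPf t0) /= => /eqP wV.
  apply/rowP => l; have : (w *m (w^T *m V)) p l = 0 by rewrite wV mxE.
  rewrite mxE big_ord1 => /eqP.
  by rewrite mulf_eq0 (negPf wp) /= => /eqP ->; rewrite mxE.
- move=> q A wA.
  have /submx_trans/(_ kV)/submxP[D AD] : (A^T <= kermx (t *: (w *m w^T))^T)%MS.
    apply/sub_kermxP; rewrite -trmx_mul -scalemxAl -mulmxA wA mulmx0 scaler0.
    exact: trmx0.
  by exists D^T; rewrite -[A]trmxK AD trmx_mul trmxK.
Qed.

(** Pivot at an index [p] with [w] nonzero: for each other index [i], take the column
    [e_i - (w_i / w_p) e_p]. Two-sparsity of [w] leaves at most one nonzero entry in row [p], hence
    disjoint supports. *)
Lemma fr_basis_outer_exists N (w : 'cV[R]_N) (t : R) :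
  t != 0 -> w != 0 -> (#|vsupport w| <= 2)%N ->
  exists (N' : nat) (V : 'M[R]_(N, N')), fr_basis (t *: (w *m w^T)) V.
Proof.
move=> t0 /matrix0Pn[p [j]]; rewrite (ord1 j) => wp w2.
case: N p w wp w2 => [[]//|N] p w wp w2.
pose V : 'M[R]_(N.+1, N) := \matrix_(i, l)
  ((i == lift p l)%:R - (w (lift p l) ord0 / w p ord0) * (i == p)%:R).
have Vp l : V p l = - (w (lift p l) ord0 / w p ord0).
  by rewrite mxE (negPf (neq_lift p l)) sub0r eqxx mulr1.
have Vlift i l : V (lift p i) l = (i == l)%:R.
  rewrite mxE (inj_eq lift_inj) [_ == p]eq_sym (negPf (neq_lift p i)).
  by rewrite mulr0 subr0.
exists N, V; split; last first.
  apply/disjoint_columnsP => i l l'.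
  case: (unliftP p i) => [i' ->|->]; rewrite ?Vlift ?Vp.
    case: (i' =P l) => [<- _|_]; last by rewrite eqxx.
    by case: (i' =P l') => // _; rewrite eqxx.
  rewrite !oppr_eq0 !mulf_eq0 !negb_or => /andP[wl _] /andP[wl' _].
  apply/eqP/negPn/negP => ll'; move: wl'.
  rewrite (three_vsupport w2 _ _ _ wp wl) ?eqxx //.
  - exact: neq_lift.
  - exact: neq_lift.
  - by rewrite (inj_eq lift_inj).
have wV : w^T *m V = 0.
  apply/rowP => l; rewrite mxE (bigD1_ord p) //= Vp [RHS]mxE [w^T _ _]mxE.
  rewrite (bigD1 l) //= big1 ?addr0.
    by rewrite [w^T _ _]mxE Vlift eqxx mulr1 mulrN mulrC divfK // addNr.
  by move=> l' ll'; rewrite Vlift (negPf ll') mulr0.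
split; first apply/row_freeP.
  exists (\matrix_(i, l) (i == lift p l)%:R); apply/matrixP => l l'.
  rewrite mxE (bigD1_ord p) //= [X in _ * X + _]mxE (negPf (neq_lift p _)).
  rewrite mulr0 add0r (bigD1 l) //= big1 ?addr0.
    by rewrite [V^T _ _]mxE Vlift eqxx mul1r !mxE (inj_eq lift_inj).
  by move=> i il; rewrite [V^T _ _]mxE Vlift (negPf il) mul0r.
apply/andP; split.
  apply/sub_kermxP.
  by rewrite -trmx_mul -scalemxAl -mulmxA wV mulmx0 scaler0 trmx0.
apply/rV_subP => v /sub_kermxP.
rewrite linearZ /= trmx_mul trmxK -scalemxAr mulmxA => /eqP.
rewrite scaler_eq0 (negPf t0) /= => /eqP vw.
have {}vw : (v *m w) 0 0 = 0.
  have : (v *m w *m w^T) 0 p = 0 by rewrite vw mxE.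
  rewrite mxE big_ord1 [w^T _ _]mxE => /eqP.
  by rewrite mulf_eq0 (negPf wp) orbF => /eqP.
(* A vector orthogonal to [w] is recovered from its non-pivot coordinates, which serve as its
   coefficients in the basis. *)
have -> : v = \row_l v 0 (lift p l) *m V^T; last exact: submxMl.
apply/rowP => i; rewrite mxE; case: (unliftP p i) => [l|] ->.
  rewrite (bigD1 l) //= big1 ?addr0.
    by rewrite [V^T _ _]mxE Vlift eqxx mulr1 [RHS]mxE.
  by move=> l' ll'; rewrite [V^T _ _]mxE Vlift eq_sym (negPf ll') mulr0.
move: vw; rewrite mxE (bigD1_ord p) //= => /eqP; rewrite addr_eq0 => /eqP vw.
apply: (mulIf wp); rewrite vw mulr_suml -sumrN; apply: eq_bigr => l _.
by rewrite [V^T _ _]mxE Vp mxE mulrN mulNr -mulrA divfK.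
Qed.

(** When the cone is a ray, all exposing matrices are positive multiples of [w *m w^T] and share one
    kernel, so the choice of [W] drops out of the recursion. *)
Lemma sdd_fr_requires_ray k N (L : set 'M[R]_N) (w : 'cV[R]_N) :
  w != 0 -> (#|vsupport w| <= 2)%N ->
  mx_perp L `&` @FW2 R N = [set t *: (w *m w^T) | t in [set t : R | 0 <= t]] ->
  (forall N' (V : 'M[R]_(N, N')), disjoint_columns V ->
    (exists S, S *m V = 1%:M) -> w^T *m V = 0 ->
    (forall q (A : 'M[R]_(N, q)), w^T *m A = 0 -> exists D, A = V *m D) ->
    sdd_fr_requires k (fr_next L V)) ->
  sdd_fr_requires k.+1 L.
Proof.
move=> w0 w2 perpE nextP.
have expE W : fr_exposing L W <-> exists2 t, 0 < t & W = t *: (w *m w^T).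
  by rewrite /fr_exposing perpE; exact: rel_interior_ray.
split.
- rewrite /fr_terminal perpE => Ez.
  have /matrix0Pn[p [j]] := w0; rewrite (ord1 j) => wp.
  have : [set 0] (1 *: (w *m w^T)) by rewrite -Ez; exists 1; rewrite //= ler01.
  rewrite /= scale1r => /matrixP/(_ p p); rewrite outer_entry mxE => /eqP.
  by rewrite mulf_eq0 (negPf wp).
- by exists (1 *: (w *m w^T)); apply/expE; exists 1; rewrite ?ltr01.
- move=> W /expE[t /lt0r_neq0 t0 ->]; split; first exact: fr_basis_outer_exists.
  move=> N' V [/(ker_basis_outerP t0)[SV wV kV] dV]; exact: nextP.
Qed.

Lemma fr_next_mul n N N' (L : set 'M[R]_n) (U : 'M[R]_(n, N))
    (V : 'M[R]_(N, N')) :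
  fr_next (fr_next L U) V = fr_next L (U *m V).
Proof.
apply/seteqP; split => X; rewrite /fr_next /= trmx_mul !mulmxA.
  by move=> [sX [_ LX]].
move=> [sX LX]; do !split => //.
by rewrite /sym_mx /= !trmx_mul trmxK sX mulmxA.
Qed.

Lemma fr_next_1 n (L : set 'M[R]_n) : L `<=` @sym_mx R n -> fr_next L 1%:M = L.
Proof.
move=> sL; apply/seteqP; split => X; rewrite /fr_next /= trmx1 mulmx1 mul1mx.
  by case.
by move=> LX; split => //; exact: sL.
Qed.

End Step.

(** * The projections and normal vectors of the successive stages *)

Section Dot.
Variables (R : realType).

Definition dot N (x y : 'cV[R]_N) : R := (x^T *m y) ord0 ord0.

Lemma dotE N (x y : 'cV[R]_N) : dot x y = \sum_i x i ord0 * y i ord0.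
Proof. by rewrite /dot mxE; apply: eq_bigr => i _; rewrite mxE. Qed.

Lemma dotC N (x y : 'cV[R]_N) : dot x y = dot y x.
Proof. by rewrite !dotE; apply: eq_bigr => i _; rewrite mulrC. Qed.

Lemma dotDr N (x y z : 'cV[R]_N) : dot x (y + z) = dot x y + dot x z.
Proof. by rewrite /dot mulmxDr mxE. Qed.

Lemma dotBr N (x y z : 'cV[R]_N) : dot x (y - z) = dot x y - dot x z.
Proof. by rewrite /dot mulmxBr !mxE. Qed.

Lemma dotZr N (x y : 'cV[R]_N) a : dot x (a *: y) = a * dot x y.
Proof. by rewrite /dot -scalemxAr mxE. Qed.

Lemma dot0r N (x : 'cV[R]_N) : dot x 0 = 0.
Proof. by rewrite /dot mulmx0 mxE. Qed.

Lemma dot_mulmxr N p (x : 'cV[R]_p) (A : 'M[R]_(p, N)) y :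
  dot x (A *m y) = dot (A^T *m x) y.
Proof. by rewrite /dot trmx_mul trmxK mulmxA. Qed.

Lemma mx_innerDr N (X Y Z : 'M[R]_N) :
  mx_inner X (Y + Z) = mx_inner X Y + mx_inner X Z.
Proof. by rewrite /mx_inner mulmxDr mxtraceD. Qed.

Lemma mx_inner_suml N K (X : 'I_K -> 'M[R]_N) Y :
  mx_inner (\sum_t X t) Y = \sum_t mx_inner (X t) Y.
Proof. by rewrite /mx_inner mulmx_suml raddf_sum. Qed.

Lemma mx_innerZl N a (X Y : 'M[R]_N) : mx_inner (a *: X) Y = a * mx_inner X Y.
Proof. by rewrite /mx_inner -scalemxAl mxtraceZ. Qed.

Lemma mx_inner_outer N (x : 'cV[R]_N) Y :
  mx_inner (x *m x^T) Y = dot x (Y *m x).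
Proof. by rewrite /mx_inner /dot -mulmxA mxtrace_mulC trace_mx11 mulmxA. Qed.

Lemma mx_inner_outer2 N (x a b : 'cV[R]_N) :
  mx_inner (x *m x^T) (a *m b^T) = dot x a * dot x b.
Proof.
rewrite mx_inner_outer (dotC x b) /dot mulmxA mulmxA -mulmxA mxE big_ord1.
by [].
Qed.

Lemma mx_inner_congr N p (x : 'cV[R]_N) (T : 'M[R]_(N, p)) Y :
  mx_inner (x *m x^T) (T *m Y *m T^T) =
  mx_inner ((T^T *m x) *m (T^T *m x)^T) Y.
Proof. by rewrite !mx_inner_outer -!mulmxA dot_mulmxr. Qed.

End Dot.

Section Stage.
Variables (R : realType) (m : nat).
Local Notation n := (2 * m).+1.
Local Notation ev := (@evec R (2 * m)).
Local Notation at_ i := (@inord (2 * m) i).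

Lemma inord_eq i j : (i <= 2 * m)%N -> (j <= 2 * m)%N ->
  (at_ i == at_ j) = (i == j).
Proof. by move=> im jm; rewrite -val_eqE /= !inordK ?ltnS. Qed.

Lemma evecE i j : (i <= 2 * m)%N -> (j <= 2 * m)%N ->
  ev i (at_ j) ord0 = (j == i)%:R.
Proof. by move=> im jm; rewrite mxE andbT inord_eq. Qed.

Lemma mulmx_evec p (A : 'M[R]_(p, n)) j i : (A *m ev j) i ord0 = A i (at_ j).
Proof.
rewrite mxE (bigD1 (at_ j)) //= big1 => [|i' ij].
  by rewrite mxE !eqxx mulr1 addr0.
rewrite [ev j _ _]mxE.
by rewrite (negPf ij) mulr0.
Qed.

Lemma dot_evecr x i : dot x (ev i) = x (at_ i) ord0.
Proof. by rewrite /dot mulmx_evec mxE. Qed.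

Lemma dot_evecl x i : dot (ev i) x = x (at_ i) ord0.
Proof. by rewrite dotC dot_evecr. Qed.

Lemma inord_ind (P : 'I_n -> Prop) :
  (forall i, (i <= 2 * m)%N -> P (at_ i)) -> forall i, P i.
Proof. by move=> Pi i; rewrite -(inord_val i); apply: Pi; rewrite -ltnS. Qed.

(** Its columns [1..k] vanish and, for [k] odd, column [k+1] is
    [e_{k+1} - e_k]; the other columns are unit vectors. *)
Definition stage_proj k : 'M[R]_n := \matrix_(i, j)
  if (0 < i <= k)%N then - [&& odd k, i == k :> nat & j == k.+1 :> nat]%:R
  else (i == j)%:R.

(** For [k = 2 * m - 1] the index [k.+2] is out of range and [inord] sends it to 0; the coefficient
    is 0 there. *)
Definition stage_vec k : 'cV[R]_n := ev k.+1 + (~~ odd k)%:R *: ev k.+2.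

Lemma stage_projE k i (x : 'cV[R]_n) : (k <= 2 * m)%N -> (i <= 2 * m)%N ->
  (stage_proj k *m x) (at_ i) ord0 =
  if (0 < i <= k)%N then - (odd k && (i == k))%:R * x (at_ k.+1) ord0
  else x (at_ i) ord0.
Proof.
move=> km im; rewrite mxE; case: ifP => ik; last first.
  rewrite (bigD1 (at_ i)) //= big1 => [|j ij]; rewrite !mxE !inordK ?ltnS // ik.
    by rewrite eqxx mul1r addr0.
  by rewrite eq_sym (negPf ij) mul0r.
under eq_bigr => j _ do rewrite mxE inordK ?ltnS // ik.
have [ok|ok] := boolP (odd k && (i == k)); last first.
  by rewrite big1 ?oppr0 ?mul0r // => j _; rewrite andbA (negPf ok) oppr0 mul0r.
(* An odd [k] differs from [2 * m], so index [k.+1] is in range. *)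
have km1 : (k.+1 <= 2 * m)%N by move: ok => /andP[]; lia.
rewrite (bigD1 (at_ k.+1)) //= big1 => [|j jk].
  by rewrite andbA ok inordK ?ltnS // eqxx addr0.
rewrite andbA ok; case: eqP => [jk1|]; last by rewrite oppr0 mul0r.
by move: jk; rewrite -val_eqE /= inordK ?ltnS // jk1 eqxx.
Qed.

Lemma stage_proj_fix k (x : 'cV[R]_n) : (k <= 2 * m)%N ->
  (forall i, (0 < i <= k)%N -> x (at_ i) ord0 = 0) ->
  (odd k -> x (at_ k.+1) ord0 = 0) -> stage_proj k *m x = x.
Proof.
move=> km x0 xk; apply/colP; apply: inord_ind => i im; rewrite stage_projE //.
case: ifP => ik //; rewrite (x0 i ik).
by case: (odd k) xk => [->|_] //; rewrite ?mulr0 ?oppr0 ?mul0r.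
Qed.

Lemma stage_proj_disjoint k : disjoint_columns (stage_proj k).
Proof.
apply/disjoint_columnsP => i j l; rewrite !mxE; case: ifP => ik.
  rewrite !oppr_eq0 !pnatr_eq0 !eqb0 !negbK.
  move=> /and3P[_ _ /eqP jk] /and3P[_ _ /eqP lk].
  by apply/val_inj; rewrite /= jk lk.
by rewrite !pnatr_eq0 !eqb0 !negbK => /eqP <- /eqP <-.
Qed.

Lemma dot_stage_vec k (x : 'cV[R]_n) : dot (stage_vec k) x =
  x (at_ k.+1) ord0 + (~~ odd k)%:R * x (at_ k.+2) ord0 :> R.
Proof. by rewrite dotC dotDr dotZr !dot_evecr. Qed.

Lemma stage_vec_at k i : (k < 2 * m)%N -> (i <= 2 * m)%N ->
  stage_vec k (at_ i) ord0 = (i == k.+1)%:R + (~~ odd k && (i == k.+2))%:R.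
Proof.
move=> km im; rewrite -dot_evecl dotDr dotZr !dot_evecl evecE //.
case ok: (odd k); first by rewrite mul0r.
by rewrite evecE ?mul1r //; lia.
Qed.

Lemma dot_stage_vec_evec k : (k < 2 * m)%N -> dot (stage_vec k) (ev k.+1) = 1.
Proof.
move=> km; rewrite dot_stage_vec evecE // eqxx.
case ok: (odd k); first by rewrite mul0r addr0.
have k2 : (k.+2 <= 2 * m)%N by lia.
have k12 : (k.+2 == k.+1) = false by lia.
by rewrite evecE // k12 mulr0 addr0.
Qed.

(** [stage_vec k] lives on indices above [k], where the rows of [stage_proj k] are unit rows. *)
Lemma stage_projTvec k : (k < 2 * m)%N ->
  (stage_proj k)^T *m stage_vec k = stage_vec k.
Proof.
move=> km; apply/colP; apply: inord_ind => i im.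
have fix1 l : (k < l <= 2 * m)%N ->
    (stage_proj k *m ev i) (at_ l) ord0 = ev i (at_ l) ord0.
  move=> /andP[kl lm]; rewrite stage_projE ?(ltnW km) //.
  by rewrite [(l <= k)%N]leqNgt kl andbF.
rewrite -!dot_evecr -dot_mulmxr !dot_stage_vec fix1 ?ltnSn //.
case ok: (odd k); first by rewrite !mul0r.
by rewrite fix1 // leqW //; lia.
Qed.

Lemma stage_proj_col0 k j : (0 < j <= k)%N -> (k <= 2 * m)%N ->
  stage_proj k *m ev j = 0.
Proof.
move=> jk km; apply/colP; apply: inord_ind => i im.
rewrite stage_projE // [RHS]mxE.
have jm : (j <= 2 * m)%N by lia.
case: ifP => ik; last first.
  have ij : (i == j) = false by apply/negbTE; lia.
  by rewrite evecE // ij.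
case ok: (odd k && (i == k)); last by rewrite oppr0 mul0r.
have ij : (k.+1 == j) = false by apply/negbTE; lia.
by rewrite evecE //; [rewrite ij mulr0|lia].
Qed.

(** A rank-one update that cuts the range down to the vectors orthogonal to [stage_vec k]. It is
    checked on vectors, coordinate by coordinate. *)
Lemma stage_projS k : (k < 2 * m)%N ->
  stage_proj k.+1 = stage_proj k - stage_proj k *m ev k.+1 *m (stage_vec k)^T.
Proof.
move=> km.
suff H (x : 'cV[R]_n) : stage_proj k.+1 *m x =
    stage_proj k *m x - dot (stage_vec k) x *: (stage_proj k *m ev k.+1).
  apply/matrixP => i; apply: inord_ind => j jm.
  rewrite -mulmx_evec H -[RHS]mulmx_evec mulmxBl.
  congr (fun_of_matrix (_ - _) _ _); rewrite -!mulmxA.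
  by rewrite [(stage_vec k)^T *m _]mx11_scalar mul_mx_scalar scalemxAr.
have subE (A B : 'cV[R]_n) c l :
    (A - c *: B) l ord0 = A l ord0 - c * B l ord0 by rewrite !mxE.
apply/colP; apply: inord_ind => i im.
rewrite stage_projE //.
rewrite subE.
rewrite dot_stage_vec.
rewrite !stage_projE ?(ltnW km) //.
rewrite !evecE //.
rewrite eqxx mulr1.
case: (ltngtP i k.+1) => [ik|ik|->].
- have ik1 : (i <= k.+1)%N by lia.
  have ik2 : (i <= k)%N by lia.
  rewrite ik2 !andbT /=.
  case: ifP => i0; last by rewrite mulr0 subr0.
  rewrite andbF; case: (odd k); case: (i == k) => /=; ring.
- have ik2 : (i <= k)%N = false by lia.
  by rewrite ik2 !andbF mulr0 subr0.
- rewrite ltnn /=; case: (odd k) => /=; ring.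
Qed.
End Stage.

(** * Left inverses of the accumulated kernel bases *)

Section Basis.
Variables (R : realType) (m : nat).
Local Notation n := (2 * m).+1.
Local Notation ev := (@evec R (2 * m)).
Local Notation at_ i := (@inord (2 * m) i).

(** The two products say that [U] is injective with the range of [stage_proj k], without fixing the
    order or the scaling of its columns. *)
Definition stage_basis k N (U : 'M[R]_(n, N)) (T : 'M[R]_(N, n)) : Prop :=
  [/\ disjoint_columns U, U *m T = stage_proj R m k & T *m U = 1%:M].

Lemma stage_basis0 : stage_basis 0 1%:M 1%:M.
Proof.
split; rewrite ?mulmx1 //.
  apply/disjoint_columnsP => i j k; rewrite !mxE !pnatr_eq0 !eqb0 !negbK.
  by move=> /eqP <- /eqP.
by apply/matrixP => i j; rewrite !mxE; case: ifP => //; case: (val i).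
Qed.

Lemma stage_basisS k N N' (U : 'M[R]_(n, N)) T (V : 'M[R]_(N, N')) S :
  (k < 2 * m)%N -> stage_basis k U T -> disjoint_columns V -> S *m V = 1%:M ->
  let w := U^T *m stage_vec R m k in
  w^T *m V = 0 ->
  (forall q (A : 'M[R]_(N, q)), w^T *m A = 0 -> exists D, A = V *m D) ->
  exists T', stage_basis k.+1 (U *m V) T'.
Proof.
move=> km [dU UT TU] dV SV w wV kV.
have UTU : stage_proj R m k *m U = U by rewrite -UT -mulmxA TU mulmx1.
have wU : w^T = (stage_vec R m k)^T *m U by rewrite trmx_mul trmxK.
have rB : (stage_vec R m k)^T *m stage_proj R m k = (stage_vec R m k)^T.
  by rewrite -[LHS]trmxK trmx_mul trmxK stage_projTvec.
have rBS : (stage_vec R m k)^T *m stage_proj R m k.+1 = 0.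
  rewrite stage_projS // mulmxBr rB !mulmxA rB.
  have -> : (stage_vec R m k)^T *m ev k.+1 = 1%:M.
    by rewrite [LHS]mx11_scalar -/(dot _ _) dot_stage_vec_evec.
  by rewrite mul1mx subrr.
have BBS : stage_proj R m k *m stage_proj R m k.+1 = stage_proj R m k.+1.
  have BB : stage_proj R m k *m stage_proj R m k = stage_proj R m k.
    by rewrite -{2}UT mulmxA UTU UT.
  by rewrite stage_projS // mulmxBr !mulmxA BB.
(* The new left inverse comes from factoring through [V]: applying [w^T] gives
   [(stage_vec k)^T *m stage_proj k.+1], which is 0. *)
have [T' T'P] : exists D, T *m stage_proj R m k.+1 = V *m D.
  by apply: kV; rewrite wU mulmxA -(mulmxA _ U) UT rB.
exists T'; split.
- exact: disjoint_columns_mul.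
- by rewrite -mulmxA -T'P mulmxA UT BBS.
- have BSU : stage_proj R m k.+1 *m (U *m V) = U *m V.
    rewrite stage_projS // mulmxBl mulmxA UTU -[X in _ - X]mulmxA.
    by rewrite [_^T *m _]mulmxA -wU wV mulmx0 subr0.
  rewrite -[T' *m _]mul1mx -SV -!mulmxA (mulmxA V) -T'P -(mulmxA T) BSU.
  by rewrite (mulmxA T) TU mul1mx.
Qed.

Lemma stage_basis_disjoint k N (U : 'M[R]_(n, N)) T :
  stage_basis k U T -> disjoint_columns T.
Proof.
move=> [dU UT TU]; apply: (disjoint_columns_section dU TU).
by rewrite UT; exact: stage_proj_disjoint.
Qed.

End Basis.

(** * Test points of the affine space *)

Section Lset.
Variables (R : realType) (m : nat).
Local Notation n := (2 * m).+1.
Local Notation ev := (@evec R (2 * m)).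
Local Notation at_ i := (@inord (2 * m) i).

Lemma at0 : at_ 0 = ord0.
Proof. by apply/val_inj; rewrite /= inordK. Qed.

(** The vector [d] is chosen so that the diagonal agrees with row 0, as
    membership in [Lset] demands. *)
Definition bordered (u v : 'cV[R]_n) : 'M[R]_n :=
  let d := \col_i (2 * u i ord0 * v i ord0) in
  ev 0 *m (ev 0)^T + u *m v^T + v *m u^T + ev 0 *m d^T + d *m (ev 0)^T.

(** Vanishing at index 0 lets [j = 1] follow the general formula, since [2 * j - 2] is then 0. *)
Lemma dot_qvec j (x : 'cV[R]_n) : (1 <= j <= m)%N -> x (at_ 0) ord0 = 0 ->
  dot (qvec R m j) x =
  x (at_ (2 * j - 2)) ord0 + x (at_ (2 * j - 1)) ord0 + x (at_ (2 * j)) ord0.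
Proof.
move=> jm x0; rewrite dotC /qvec; case: eqP => [->|j1].
  by rewrite dotDr !dot_evecr x0 add0r.
by rewrite !dotDr !dot_evecr.
Qed.

Lemma Lset_bordered (u v : 'cV[R]_n) :
  u (at_ 0) ord0 = 0 -> v (at_ 0) ord0 = 0 ->
  (forall j, (1 <= j <= m)%N -> dot (qvec R m j) u * dot (qvec R m j) v = 0) ->
  Lset (bordered u v).
Proof.
move=> u0 v0 quv.
have ev0 i : (0 < i <= 2 * m)%N -> ev 0 (at_ i) ord0 = 0.
  by move=> /andP[i0 im]; rewrite evecE // -[i]prednK.
have q0 j : (1 <= j <= m)%N -> dot (qvec R m j) (ev 0) = 0.
  move=> jm; rewrite dotC /qvec; case: eqP => [_|j1].
    by rewrite dotDr !dot_evecr !ev0 ?addr0 //; lia.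
  by rewrite !dotDr !dot_evecr !ev0 ?addr0 //; lia.
have entry i j : bordered u v i j = (i == at_ 0)%:R * (j == at_ 0)%:R
   + u i ord0 * v j ord0 + v i ord0 * u j ord0
   + (i == at_ 0)%:R * (2 * u j ord0 * v j ord0)
   + (2 * u i ord0 * v i ord0) * (j == at_ 0)%:R.
  by rewrite !mxE !big_ord1 !mxE !andbT.
split.
- apply/matrixP => i j; rewrite mxE !entry; ring.
- rewrite entry -at0 eqxx u0 v0; rewrite /=; ring.
- move=> i; rewrite -at0 => i0; rewrite !entry eqxx (negPf i0) u0 v0.
  rewrite /=; ring.
- move=> j jm; rewrite !mx_innerDr !mx_inner_outer2 q0 //.
  by rewrite [dot _ v * _]mulrC quv // !(mul0r, mulr0, addr0).
Qed.

End Lset.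

(** * The exposing cone at each stage *)

Section Generators.
Variables (R : realType) (m : nat).
Local Notation n := (2 * m).+1.
Local Notation ev := (@evec R (2 * m)).
Local Notation at_ i := (@inord (2 * m) i).
Local Notation proj := (stage_proj R m).

Lemma mx_inner_bordered (h u v : 'cV[R]_n) :
  mx_inner (h *m h^T) (bordered u v) =
  dot h (ev 0) ^+ 2 + 2 * (dot h u * dot h v)
  + 2 * dot h (ev 0) * dot h (\col_i (2 * u i ord0 * v i ord0)).
Proof. by rewrite !mx_innerDr !mx_inner_outer2; ring. Qed.

Lemma mulmx_bordered (B : 'M[R]_n) (u v : 'cV[R]_n) :
  B *m ev 0 = ev 0 -> B *m u = u -> B *m v = v ->
  let d := \col_i (2 * u i ord0 * v i ord0) in B *m d = d ->
  B *m bordered u v *m B^T = bordered u v.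
Proof.
move=> Be Bu Bv d Bd.
have cong (a b : 'cV[R]_n) : B *m a = a -> B *m b = b ->
    B *m (a *m b^T) *m B^T = a *m b^T.
  by move=> Ba Bb; rewrite mulmxA Ba -mulmxA -trmx_mul Bb.
by rewrite /bordered !mulmxDr !mulmxDl !cong.
Qed.

(** These are the pulled-back generators [T^T *m g t]. [hB] says that the transposed projection
    fixes them, and [hL] tests orthogonality on the points that come from the reduced space. *)
Variables (k K : nat) (h : 'I_K -> 'cV[R]_n).
Hypothesis km : (k <= 2 * m)%N.
Hypothesis h2 : forall t, (#|vsupport (h t)| <= 2)%N.
Hypothesis hB : forall t x, dot (h t) (proj k *m x) = dot (h t) x.
Hypothesis BB : proj k *m proj k = proj k.
Hypothesis hL : forall Y, Lset Y -> proj k *m Y *m (proj k)^T = Y ->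
  \sum_t mx_inner (h t *m (h t)^T) Y = 0.

Local Notation "h `_[ i ]" := (h (at_ i) ord0) (at level 2, format "h `_[ i ]").

Lemma proj_evec0 : proj k *m ev 0 = ev 0.
Proof.
apply: stage_proj_fix => // [i /andP[i0 ik]|ok]; rewrite evecE //.
- by rewrite -[i]prednK.
- exact: leq_trans ik km.
- by lia.
Qed.

(** The test point [bordered 0 0] is [e_0 e_0^T], which yields a vanishing sum of squares. *)
Lemma generator_at0 t : (h t)`_[0] = 0.
Proof.
apply: (@sum_sqr_eq0 R 'I_K (fun t => (h t)`_[0])).
rewrite -[RHS](hL (Y := bordered 0 0)).
- apply: eq_bigr => s _; rewrite mx_inner_bordered dot0r dot_evecr.
  rewrite [\col_i _](_ : _ = 0) ?dot0r; first ring.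
  by apply/colP => i; rewrite !mxE !mulr0.
- by apply: Lset_bordered; rewrite ?mxE // => j _; rewrite dot0r mul0r.
- apply: mulmx_bordered; rewrite ?mulmx0 ?proj_evec0 //.
  rewrite [\col_i _](_ : _ = 0) ?mulmx0 //.
  by apply/colP => i; rewrite !mxE !mulr0.
Qed.

Lemma generator_low t j : (0 < j <= k)%N -> (h t)`_[j] = 0.
Proof. by move=> jk; rewrite -dot_evecr -hB stage_proj_col0 // dot0r. Qed.

Lemma generator_test (u v : 'cV[R]_n) : u`_[0] = 0 -> v`_[0] = 0 ->
  proj k *m u = u -> proj k *m v = v ->
  let d := \col_i (2 * u i ord0 * v i ord0) in proj k *m d = d ->
  (forall j, (1 <= j <= m)%N -> dot (qvec R m j) u * dot (qvec R m j) v = 0) ->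
  \sum_t dot (h t) u * dot (h t) v = 0.
Proof.
move=> u0 v0 Bu Bv d Bd quv.
apply: (mulfI (_ : 2 != 0 :> R)); first by rewrite pnatr_eq0.
rewrite mulr0 -[RHS](hL (Lset_bordered u0 v0 quv)); last first.
  by apply: mulmx_bordered => //; exact: proj_evec0.
rewrite mulr_sumr; apply: eq_bigr => t _.
rewrite mx_inner_bordered dot_evecr generator_at0; ring.
Qed.

(** The test vector [u] is orthogonal to every [q_i]: its first two terms cancel on [q_j], its last
    two on [q_{j+1}]. Testing with [u = v] then gives a sum of squares. *)
Lemma generator_alternate t j : (k < 2 * j - 1)%N -> (j <= m)%N ->
  (h t)`_[2 * j - 1] = (h t)`_[2 * j] - (j < m)%:R * (h t)`_[(2 * j).+1].
Proof.
move=> kj jm.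
pose u := ev (2 * j - 1) - ev (2 * j) + (j < m)%:R *: ev (2 * j).+1.
(* For [j = m] the index [2 * j + 1] is out of range and [inord] sends it to 0;
   the coefficient of that vector is then 0. *)
have uE i : (i <= 2 * m)%N ->
    u`_[i] = (i == 2 * j - 1)%N%:R - (i == 2 * j)%N%:R + (i == (2 * j).+1)%N%:R.
  move=> im; have j1 : (2 * j - 1 <= 2 * m)%N by lia.
  have j2 : (2 * j <= 2 * m)%N by lia.
  have -> : u`_[i] = (ev (2 * j - 1))`_[i] - (ev (2 * j))`_[i] +
      (j < m)%:R * (ev (2 * j).+1)`_[i] by rewrite !mxE.
  rewrite (evecE _ j1 im) (evecE _ j2 im); case: (ltnP j m) => [jm'|mj].
    by rewrite evecE ?mul1r //; lia.
  have -> : (i == (2 * j).+1)%N = false by lia.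
  by rewrite mul0r.
have ulow i : (i < 2 * j - 1)%N -> u`_[i] = 0.
  move=> ij; rewrite uE; last lia.
  have -> : (i == 2 * j - 1)%N = false by lia.
  have -> : (i == 2 * j)%N = false by lia.
  have -> : (i == (2 * j).+1)%N = false by lia.
  by rewrite subr0 addr0.
have ufix (x : 'cV[R]_n) :
    (forall i, u`_[i] = 0 -> x`_[i] = 0) -> proj k *m x = x.
  (* For odd [k], parity turns [k < 2 * j - 1] into [k.+1 < 2 * j - 1]. *)
  move=> ux; apply: stage_proj_fix => // [i /andP[i0 ik]|ok]; apply/ux/ulow.
    by lia.
  by lia.
have u0 : u`_[0] = 0 by apply: ulow; lia.
have /sum_sqr_eq0/(_ t) : \sum_t dot (h t) u * dot (h t) u = 0.
  apply: generator_test => //; [exact: ufix|exact: ufix|apply: ufix|].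
    by move=> i ui; rewrite mxE ui mulr0.
  move=> i im; rewrite dot_qvec // !uE; try lia.
  have -> : (2 * i - 2 == 2 * j - 1)%N = false by lia.
  have -> : (2 * i - 2 == 2 * j)%N = (i == j.+1) by lia.
  have -> : (2 * i - 2 == (2 * j).+1)%N = false by lia.
  have -> : (2 * i - 1 == 2 * j - 1)%N = (i == j) by lia.
  have -> : (2 * i - 1 == 2 * j)%N = false by lia.
  have -> : (2 * i - 1 == (2 * j).+1)%N = (i == j.+1) by lia.
  have -> : (2 * i == 2 * j - 1)%N = false by lia.
  have -> : (2 * i == 2 * j)%N = (i == j) by lia.
  have -> : (2 * i == (2 * j).+1)%N = false by lia.
  rewrite /=; ring.
rewrite dotDr dotBr dotZr !dot_evecr => H; lra.
Qed.

Lemma generator_vanish j : (k < 2 * j - 2)%N -> (j <= m)%N ->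
  (forall t, (j < m)%:R * (h t)`_[(2 * j).+1] = 0) ->
  forall t, (h t)`_[2 * j - 1] = 0 /\ (h t)`_[2 * j] = 0.
Proof.
move=> kj jm hj.
have hab t : (h t)`_[2 * j - 1] = (h t)`_[2 * j].
  by rewrite generator_alternate ?hj ?subr0 //; lia.
suff ha t : (h t)`_[2 * j - 1] = 0 by move=> t; rewrite -hab ha.
have jp : (2 * j - 2 <= 2 * m)%N by lia.
have ja : (2 * j - 1 <= 2 * m)%N by lia.
have jb : (2 * j <= 2 * m)%N by lia.
have pa : (2 * j - 2 == 2 * j - 1)%N = false by lia.
have ap : (2 * j - 1 == 2 * j - 2)%N = false by lia.
have ab : (2 * j - 1 == 2 * j)%N = false by lia.
have ba : (2 * j == 2 * j - 1)%N = false by lia.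
have bp : (2 * j == 2 * j - 2)%N = false by lia.
have hap s : (h s)`_[2 * j - 1] * (h s)`_[2 * j - 2] = 0.
  have [->|ha] := eqVneq (h s)`_[2 * j - 1] 0; first by rewrite mul0r.
  have hb : (h s)`_[2 * j] != 0 by rewrite -hab.
  have -> : (h s)`_[2 * j - 2] = 0; last exact: mulr0.
  apply: (three_vsupport (h2 s) _ _ _ ha hb); rewrite inord_eq //.
  - by rewrite ab.
  - by rewrite ap.
  - by rewrite bp.
apply: (@sum_sqr_eq0 R 'I_K (fun t => (h t)`_[2 * j - 1])) => {t}.
(* [u] is orthogonal to all [q_i] except [q_j], and [v] to [q_j]. The projection makes [v]
   admissible even when [2 * j - 2 = k.+1], where it adds an entry at [k]; by [hB] the generators do
   not see it, and by [hap] the sum reduces to squares. *)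
pose u := ev (2 * j - 1); pose v := u - proj k *m ev (2 * j - 2).
have vE i : (i <= 2 * m)%N -> (k < i)%N || (i == 0%N) ->
    v`_[i] = (i == 2 * j - 1)%N%:R - (i == 2 * j - 2)%N%:R.
  move=> im ki; have -> : v`_[i] = u`_[i] - (proj k *m ev (2 * j - 2))`_[i].
    by rewrite !mxE.
  have ik : (0 < i <= k)%N = false by lia.
  by rewrite stage_projE // ik !evecE.
have ufix (x : 'cV[R]_n) :
    (forall i, u`_[i] = 0 -> x`_[i] = 0) -> proj k *m x = x.
  move=> ux; apply: stage_proj_fix => // [i /andP[i0 ik]|ok]; apply: ux.
    have ia : (i == 2 * j - 1)%N = false by lia.
    by rewrite evecE ?ia //; lia.
  have ia : (k.+1 == 2 * j - 1)%N = false by lia.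
  by rewrite evecE ?ia //; lia.
have a0 : (0 == 2 * j - 1)%N = false by lia.
have p0 : (0 == 2 * j - 2)%N = false by lia.
have u0 : u`_[0] = 0 by rewrite evecE ?a0.
have v0 : v`_[0] = 0 by rewrite vE // ?eqxx ?orbT // a0 p0 subr0.
have := @generator_test u v u0 v0.
have -> : \sum_t dot (h t) u * dot (h t) v =
    \sum_t (h t)`_[2 * j - 1] * (h t)`_[2 * j - 1].
  apply: eq_bigr => t _.
  by rewrite dotBr hB !dot_evecr mulrBr hap subr0.
apply.
- exact: ufix.
- by rewrite mulmxBr mulmxA BB ufix.
- by apply: ufix => i ui; rewrite mxE ui mulr0 mul0r.
- move=> i im; have [->|ij] := eqVneq i j.
    rewrite [X in _ * X]dot_qvec //; last lia.
    rewrite !vE ?eqxx ?pa ?ap ?ba ?bp //; try lia.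
    by rewrite /= !sub0r subr0 oppr0 addr0 addNr mulr0.
  rewrite dot_qvec // !evecE //; try lia.
  have -> : (2 * i - 2 == 2 * j - 1)%N = false by lia.
  have -> : (2 * i - 1 == 2 * j - 1)%N = false by lia.
  have -> : (2 * i == 2 * j - 1)%N = false by lia.
  by rewrite !addr0 mul0r.
Qed.

Lemma generator_high j : (k < 2 * j - 2)%N -> (j <= m)%N ->
  forall t, (h t)`_[2 * j - 1] = 0 /\ (h t)`_[2 * j] = 0.
Proof.
move=> + jm; have [d def_m] : exists d, (j + d)%N = m by exists (m - j)%N; lia.
elim: d j jm def_m => [|d IH] j jm def_m kj t.
  have jm' : (j < m)%N = false by lia.
  by apply: generator_vanish => // s; rewrite jm' mul0r.
apply: generator_vanish => // s.
have [|||+ _] := IH j.+1 _ _ _ s; try lia.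
have -> : (2 * j.+1 - 1 = (2 * j).+1)%N by lia.
by move=> ->; rewrite mulr0.
Qed.

Lemma generatorE t :
  h t = if (k < 2 * m)%N then (h t)`_[k.+1] *: stage_vec R m k else 0.
Proof.
apply/colP; apply: inord_ind => i im.
(* The index [j] belongs to the pair [2 * i - 1], [2 * i] with [i = uphalf j]. The bound puts that
   pair in the range of [generator_high], from [k + 3] for even [k] and from [k + 2] for odd [k]. *)
have high j : (k.+2 < j + odd k)%N -> (j <= 2 * m)%N -> (h t)`_[j] = 0.
  move=> kj jm; have := @generator_high (uphalf j) _ _ t; case oj: (odd j).
    have -> : (2 * uphalf j - 1 = j)%N by lia.
    by move=> H; apply H; lia.
  have -> : (2 * uphalf j = j)%N by lia.
  by move=> H; apply H; lia.
have low j : (j <= k)%N -> (h t)`_[j] = 0.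
  by case: j => [|j] jk; [exact: generator_at0|exact: generator_low].
case: ifP => k2m; last by rewrite mxE low //; lia.
rewrite mxE stage_vec_at //.
case: (ltngtP i k.+1) => [ik|ik|ik].
- have -> : (i == k.+2) = false by lia.
  by rewrite andbF addr0 mulr0 low.
- rewrite add0r; case: (eqVneq i k.+2) => [ik2|ik2]; last first.
    by rewrite andbF mulr0 high //; lia.
  rewrite andbT; case ok: (odd k); first by rewrite mulr0 high //; lia.
  (* For even [k] the entries at [k.+1] and [k.+2] agree, because the next one, if in range, is
     already 0. *)
  rewrite mulr1 ik2; have := @generator_alternate t (k./2).+1 _ _.
  have -> : (2 * k./2.+1 - 1 = k.+1)%N by lia.
  have -> : (2 * k./2.+1 = k.+2)%N by lia.
  move=> ->; [|lia|lia].
  case: (ltnP _ _) => km2; last by rewrite mul0r subr0.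
  by rewrite (high k.+3) ?mulr0 ?subr0 //; lia.
- have -> : (i == k.+2) = false by lia.
  by rewrite ik andbF addr0 mulr1.
Qed.

End Generators.

(** * Transfer to the reduced spaces and induction on the stages *)

Section Stages.
Variables (R : realType) (m : nat).
Local Notation n := (2 * m).+1.
Local Notation ev := (@evec R (2 * m)).
Local Notation at_ i := (@inord (2 * m) i).
Local Notation "h `_[ i ]" := (h (at_ i) ord0) (at level 2, format "h `_[ i ]").
Local Notation proj := (stage_proj R m).
Local Notation svec := (stage_vec R m).

(** [generatorE] applies to [T^T *m g t], and [U^T] recovers [g t]. A point [Y] fixed by congruence
    with the projection equals [U X U^T] for [X = T Y T^T]. *)
Lemma mx_perp_generators k N (U : 'M[R]_(n, N)) T K (g : 'I_K -> 'cV[R]_N) :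
  (k <= 2 * m)%N -> stage_basis k U T ->
  (forall t, (#|vsupport (g t)| <= 2)%N) ->
  mx_perp (fr_next (@Lset R m) U) (\sum_t g t *m (g t)^T) ->
  forall t, g t = if (k < 2 * m)%N
    then (T^T *m g t)`_[k.+1] *: (U^T *m svec k) else 0.
Proof.
move=> km UTb g2 [_ gL] t; have [dU UT TU] := UTb.
have UTU : proj k *m U = U by rewrite -UT -mulmxA TU mulmx1.
have TUT : T *m proj k = T by rewrite -UT mulmxA TU mul1mx.
have BB : proj k *m proj k = proj k by rewrite -{2}UT mulmxA UTU UT.
have hE : T^T *m g t = if (k < 2 * m)%N
    then (T^T *m g t)`_[k.+1] *: svec k else 0; last first.
  rewrite -[LHS]mul1mx -trmx1 -TU trmx_mul -mulmxA [in LHS]hE.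
  by case: ifP => _; rewrite ?mulmx0 // scalemxAr.
apply: (@generatorE R m k K (fun t => T^T *m g t)) => //.
- move=> s; apply: leq_trans (g2 s); apply: card_vsupport_tr_mul.
  exact: stage_basis_disjoint UTb.
- by move=> s x; rewrite -!dot_mulmxr mulmxA TUT.
- move=> Y LY BY.
  transitivity (mx_inner (\sum_t g t *m (g t)^T) (T *m Y *m T^T)).
    by rewrite mx_inner_suml; apply: eq_bigr => s _; rewrite mx_inner_congr.
  apply: gL; split.
    have [sY _ _ _] := LY.
    by rewrite /sym_mx /= !trmx_mul trmxK sY mulmxA.
  by rewrite !mulmxA UT -mulmxA -trmx_mul UT BY.
Qed.

(** For odd [k], row [k] of [Y] is minus row [k.+1]: the two diagonal entries agree while the
    entries of row 0 are opposite, so the diagonal condition makes all of them 0. For even positive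
    [k], row [k] is 0 and the constraint of [q_{k/2+1}] reduces to [stage_vec k]; for [k = 0] they
    coincide. *)
Lemma Lset_stage_vec k (Y : 'M[R]_n) : (k < 2 * m)%N -> Lset Y ->
  proj k *m Y = Y -> dot (svec k) (Y *m svec k) = 0.
Proof.
move=> km [sY Y00 Yd Yq] BY.
have Yrow i j : (i <= 2 * m)%N -> Y (at_ i) j =
    if (0 < i <= k)%N then - (odd k && (i == k))%:R * Y (at_ k.+1) j
    else Y (at_ i) j.
  move=> im; rewrite -{1}BY -(inord_val j) -mulmx_evec -mulmxA.
  rewrite stage_projE ?(ltnW km) //.
  by rewrite !mulmx_evec.
have symY i j : Y i j = Y j i by rewrite -{1}sY mxE.
case ok: (odd k).
  have vE : svec k = ev k.+1 by rewrite /stage_vec ok scale0r addr0.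
  rewrite vE dot_evecl mulmx_evec.
  have k0 : (0 < k)%N by lia.
  have Yk j : Y (at_ k) j = - Y (at_ k.+1) j.
    by rewrite Yrow ?(ltnW km) // k0 leqnn ok eqxx mulN1r.
  have Yk0 : at_ k != ord0 by rewrite -at0 inord_eq ?(ltnW km) // -lt0n.
  have Yk1 : at_ k.+1 != ord0 by rewrite -at0 inord_eq.
  have := Yd _ Yk0; have := Yd _ Yk1.
  rewrite !Yk !(symY ord0) Yk (symY _ (at_ k)) Yk => -> H; lra.
have k1 : (1 <= k./2.+1 <= m)%N by lia.
have := Yq _ k1; rewrite mx_inner_outer.
rewrite /qvec; case: eqP => [k20|k20].
  have k0 : k = 0%N by lia.
  by rewrite /stage_vec k0 /= scale1r.
have -> : (2 * k./2.+1 - 2)%N = k by lia.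
have -> : (2 * k./2.+1 - 1)%N = k.+1 by lia.
have -> : (2 * k./2.+1)%N = k.+2 by lia.
have k0 : (0 < k)%N by lia.
have Yk j : Y (at_ k) j = 0.
  by rewrite Yrow ?(ltnW km) // k0 leqnn ok oppr0 mul0r.
have Ye : Y *m ev k = 0.
  by apply/colP => i; rewrite mulmx_evec symY Yk mxE.
have eY x : dot (ev k) (Y *m x) = 0.
  by rewrite dot_evecl mxE big1 // => i _; rewrite Yk mul0r.
have -> : ev k + ev k.+1 + ev k.+2 = ev k + svec k.
  by rewrite /stage_vec ok scale1r addrA.
by rewrite mulmxDr Ye add0r dotC dotDr dotC eY add0r dotC.
Qed.

Lemma stage_vec_sparse k : (#|vsupport (svec k)| <= 2)%N.
Proof.
apply: leq_trans (_ : #|[set at_ k.+1; at_ k.+2]%SET| <= 2)%N; last first.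
  by rewrite cards2; case: eqP.
apply/subset_leq_card/fintype.subsetP => i; rewrite in_vsupport !finset.inE.
apply: contraR; rewrite negb_or => /andP[i1 i2].
by rewrite !mxE (negPf i1) (negPf i2) mulr0 addr0.
Qed.

Lemma mx_perp_stage k N (U : 'M[R]_(n, N)) T :
  (k < 2 * m)%N -> stage_basis k U T ->
  let w := U^T *m svec k in
  mx_perp (fr_next (@Lset R m) U) `&` @FW2 R N =
  [set t *: (w *m w^T) | t in [set t : R | 0 <= t]].
Proof.
move=> km UTb w; apply/seteqP; split => Z /=.
  move=> [pZ [K [g [g2 Zg]]]]; move: pZ; rewrite Zg => pZ.
  have gE := mx_perp_generators (ltnW km) UTb g2 pZ.
  (* Every generator is a multiple of [w], so the squared coefficients add up. *)
  exists (\sum_t (T^T *m g t)`_[k.+1] ^+ 2).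
    by apply: sumr_ge0 => t _; exact: sqr_ge0.
  rewrite scaler_suml; apply: eq_bigr => t _; rewrite {2 3}gE km.
  by rewrite -/w linearZ /= -scalemxAl -scalemxAr scalerA expr2.
move=> [t t0 <-]; have [dU UT TU] := UTb.
split; last first.
  exists 1%N, (fun=> Num.sqrt t *: w); split => [_|].
    apply: leq_trans (stage_vec_sparse k).
    apply: leq_trans (card_vsupport_tr_mul (svec k) dU).
    apply/subset_leq_card/fintype.subsetP => i.
    rewrite [in X in X -> _]in_vsupport mxE mulf_eq0 negb_or => /andP[_ wi].
    by rewrite in_vsupport.
  by rewrite big_ord1 linearZ /= -scalemxAl -scalemxAr scalerA -expr2 sqr_sqrtr.
split; first by rewrite /sym_mx /= linearZ /= trmx_mul trmxK.
move=> X [sX LX]; rewrite mx_innerZl mx_inner_outer.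
have -> : dot w (X *m w) = dot (svec k) (U *m X *m U^T *m svec k).
  by rewrite -!mulmxA [RHS]dot_mulmxr.
have BY : proj k *m (U *m X *m U^T) = U *m X *m U^T.
  by rewrite !mulmxA -UT -(mulmxA U T) TU mulmx1.
by rewrite (Lset_stage_vec km LX BY) mulr0.
Qed.

Lemma fr_terminal_stage N (U : 'M[R]_(n, N)) T :
  stage_basis (2 * m) U T -> fr_terminal (fr_next (@Lset R m) U).
Proof.
move=> UTb; apply/seteqP; split => Z /=.
  move=> [pZ [K [g [g2 Zg]]]]; move: pZ; rewrite Zg => pZ.
  apply: big1 => t _; rewrite (mx_perp_generators (leqnn _) UTb g2 pZ) ltnn.
  by rewrite mul0mx.
move=> ->; split.
  split; first by rewrite /sym_mx /= trmx0.
  by move=> X _; rewrite /mx_inner mul0mx mxtrace0.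
by exists 0%N, (fun=> 0); split => [[]|] //; rewrite big_ord0.
Qed.

Lemma stage_requires d k N (U : 'M[R]_(n, N)) T : (k + d = 2 * m)%N ->
  stage_basis k U T -> sdd_fr_requires d (fr_next (@Lset R m) U).
Proof.
elim: d k N U T => [|d IH] k N U T kd UTb.
  by apply: (@fr_terminal_stage _ _ T); rewrite -kd addn0.
have km : (k < 2 * m)%N by lia.
have [dU UT TU] := UTb.
apply: (sdd_fr_requires_ray _ _ (mx_perp_stage km UTb)).
(* The ray is not trivial: [T^T] maps [w] back to [stage_vec k], whose entry at [k.+1] is 1. *)
- apply/eqP => w0; have : (proj k)^T *m svec k = 0.
    by rewrite -UT trmx_mul -mulmxA w0 mulmx0.
  rewrite stage_projTvec // => v0; have := dot_stage_vec_evec R km.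
  by rewrite v0 dotC dot0r => /esym/eqP; rewrite oner_eq0.
- apply: leq_trans (stage_vec_sparse k); exact: card_vsupport_tr_mul.
- move=> N' V dV [S SV] wV kV; rewrite fr_next_mul.
  have [T' UTb'] := stage_basisS km UTb dV SV wV kV.
  by apply: (IH k.+1 _ _ T') => //; rewrite addSnnS.
Qed.

End Stages.

Theorem theorem4p1 (R : realType) (m : nat) (hm : (1 <= m)%N) :
  @sdd_fr_requires R (2 * m)%N (2 * m).+1 (@Lset R m).
Proof.
(* Stage 0 has the identity as its accumulated basis. *)
rewrite -[X in sdd_fr_requires _ X]fr_next_1; last by move=> Y [].
exact: (stage_requires (add0n _) (stage_basis0 R m)).
Qed.
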